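(* Let $q$ be an indeterminate. For $n\ge 0$ put $[n]=[n]_q=1+q+\dots+q^{n-1}$ and $[n]!=[1][2]\cdots[n]$. Consider the formal power series in $x$ over the field $\mathbb{Q}(q)$ $$\exp_q(x)=\sum_{n\ge 0}\frac{x^n}{[n]!},\qquad \operatorname{Exp}_q(x)=\sum_{n\ge 0}q^{\binom n2}\frac{x^n}{[n]!}.$$ Let $e_n(q)$ and $E_n(q)$ ($n\ge1$) be the unique elements of $\mathbb{Q}(q)$ such that $$\exp_q(x)=\prod_{n\ge 1}\bigl(1+e_n(q)x^n\bigr),\qquad \operatorname{Exp}_q(x)=\prod_{n\ge 1}\bigl(1+E_n(q)x^n\bigr).$$ Then $$e_n(q)=\sum_{d\mid n,\ d>1}(-1)^d\frac{e_{n/d}(q)^d}{d}+\frac{(1-q)^{n-1}}{n[n]},\qquad E_n(q)=\sum_{d\mid n,\ d>1}(-1)^d\frac{E_{n/d}(q)^d}{d}+\frac{(q-1)^{n-1}}{n[n]}$$ for all $n\ge1$, we have $\operatorname{Exp}_q(x)=\exp_{q^{-1}}(x)=1/\exp_q(-x)$, and for all $n\ge 0$ $$e_{2n+1}(q)=E_{2n+1}(q)=e_{2n+1}(1/q).$$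
   Context: A power product expansion of a formal power series $f(x)=\sum_{n\ge0}a_nx^n$ with $a_0=1$ is a representation $f(x)=\prod_{n\ge1}(1+g_nx^n)$; the coefficients $g_n$ exist and are uniquely determined (the first $n$ factors of the product must agree with $f$ up to order $x^n$). An empty divisor sum is $0$. *)

(* Defs.v *)
From HB Require Import structures.
From mathcomp Require Import all_boot all_order all_algebra.

Set Implicit Arguments.
Unset Strict Implicit.
Unset Printing Implicit Defensive.
Import Order.TTheory GRing.Theory Num.Theory.
Local Open Scope ring_scope.

Section PowerSeries.

Variable F : fieldType.

(* A formal power series is its coefficient sequence: [f n] is the coefficient
   of x^n, and two series are equal when they are pointwise equal ([=1]). *)
Definition fps := nat -> F.

Definition fps_one : fps := fun n => (n == 0%N)%:R.

Definition fps_mul (f g : fps) : fps :=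
  fun n => \sum_(i < n.+1) f i * g (n - i)%N.

(* f(-x) *)
Definition fps_negx (f : fps) : fps := fun n => (-1) ^+ n * f n.

(* f = 1/g *)
Definition fps_reciprocal (f g : fps) : Prop := fps_mul f g =1 fps_one.

Definition partial_product (g : nat -> F) (N : nat) : {poly F} :=
  \prod_(1 <= i < N.+1) (1 + g i *: 'X^i).

(* f(x) = prod_(n >= 1) (1 + g_n x^n) in the x-adic sense: every coefficient of
   the partial products is eventually equal to that of f. The value [g 0] is
   irrelevant. See [power_productP] for the finite form of the condition. *)
Definition power_product (f : fps) (g : nat -> F) : Prop :=
  forall k, exists N0, forall N, (N0 <= N)%N -> (partial_product g N)`_k = f k.

Lemma partial_productS g N :
  partial_product g N.+1 =
  partial_product g N + g N.+1 *: (partial_product g N * 'X^(N.+1)).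
Proof.
rewrite /partial_product [LHS]big_nat_recr //= mulrDr mulr1.
by rewrite scalerAr.
Qed.

Lemma partial_product_stable g N k : (k <= N)%N ->
  (partial_product g N)`_k = (partial_product g k)`_k.
Proof.
elim: N => [|N IHN]; first by rewrite leqn0 => /eqP->.
rewrite leq_eqVlt => /predU1P[->//|lekN].
by rewrite partial_productS coefD coefZ coefMXn lekN mulr0 addr0 IHN.
Qed.

Lemma partial_product0 g N : (partial_product g N)`_0 = 1.
Proof.
by rewrite partial_product_stable // /partial_product big_geq // coef1.
Qed.

Lemma partial_product_top g N :
  (partial_product g N.+1)`_N.+1 = (partial_product g N)`_N.+1 + g N.+1.
Proof.
rewrite partial_productS coefD coefZ coefMXn ltnn subnn.
by rewrite partial_product0 mulr1.
Qed.

Lemma power_productP f g :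
  power_product f g <->
  forall N k, (k <= N)%N -> (partial_product g N)`_k = f k.
Proof.
split=> [fg N k lekN|fg k]; last by exists k => N; apply: fg.
have [N0 fN0] := fg k.
rewrite (partial_product_stable _ lekN) -(fN0 (maxn N0 k)) ?leq_maxl //.
by rewrite partial_product_stable ?leq_maxr.
Qed.

Lemma eq_partial_product g h N :
  (forall i, (0 < i <= N)%N -> g i = h i) ->
  partial_product g N = partial_product h N.
Proof. by move=> gh; apply: eq_big_nat => i lei; rewrite gh. Qed.

Lemma power_product_exists f : f 0%N = 1 -> exists g, power_product f g.
Proof.
move=> f0; pose fix G n : nat -> F := if n is m.+1 then
  fun i => if i == m.+1 then f m.+1 - (partial_product (G m) m)`_m.+1
           else G m i else fun=> 0.
have GE n i : (i <= n)%N -> G n i = G i i.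
  elim: n => [|n IHn]; first by rewrite leqn0 => /eqP->.
  rewrite leq_eqVlt => /predU1P[->//|lein] /=.
  by rewrite ltn_eqF // IHn.
exists (fun i => G i i) => k; exists k => N lekN.
rewrite partial_product_stable //; case: k {lekN} => [|k].
  by rewrite partial_product0.
rewrite partial_product_top /= eqxx -(@eq_partial_product (G k)) ?subrKC //.
by move=> i /andP[_]; apply: GE.
Qed.

Lemma power_product_unique f g h : power_product f g -> power_product f h ->
  forall n, (0 < n)%N -> g n = h n.
Proof.
move=> /power_productP fg /power_productP fh.
elim/ltn_ind=> -[//|n] IHn _; apply: (@addrI _ (partial_product g n)`_n.+1).
rewrite -partial_product_top fg // -(fh _ _ (leqnn _)) partial_product_top.
rewrite (@eq_partial_product g h) // => i /andP[i0 lein].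
exact: IHn.
Qed.

Definition qint (q : F) (n : nat) : F := \sum_(i < n) q ^+ i.

Definition qfact (q : F) (n : nat) : F := \prod_(1 <= i < n.+1) qint q i.

(* exp_q(x), with the parameter q allowed to be any element of the field *)
Definition qexp (q : F) : fps := fun n => (qfact q n)^-1.

(* Exp_q(x) *)
Definition qExp (q : F) : fps := fun n => q ^+ 'C(n, 2) / qfact q n.

End PowerSeries.

Notation Qq := {fraction {poly rat}}.

Definition qvar : Qq := tofrac 'X.

(* p(1/q), for a polynomial p(q) *)
Definition poly_at_qinv (p : {poly rat}) : Qq :=
  (map_poly (fun c : rat => tofrac c%:P : Qq) p).[qvar^-1].

(* r(1/q), for a rational function r(q), computed on the numerator and the
   denominator of a representative of r; by [at_qinv_div] any other choice of
   numerator and denominator gives the same value. *)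
Definition at_qinv (r : Qq) : Qq :=
  poly_at_qinv \n_(repr r) / poly_at_qinv \d_(repr r).

Lemma frac_repr (R : idomainType) (r : {fraction R}) :
  r * tofrac \d_(repr r) = tofrac \n_(repr r).
Proof.
rewrite -{1}[r](reprK r); unlock FracField.tofrac.
rewrite -[LHS]FracField.pi_mul; apply/eqmodP => /=.
rewrite FracField.equivfE /FracField.mulf /=.
by rewrite !numden_Ratio ?mulf_neq0 ?denom_ratioP ?oner_neq0 // !mulr1 mulrC.
Qed.

Lemma poly_at_qinvM p1 p2 :
  poly_at_qinv (p1 * p2) = poly_at_qinv p1 * poly_at_qinv p2.
Proof.
rewrite /poly_at_qinv -hornerM; congr (_.[_]).
exact: (rmorphM (map_poly (@FracField.tofrac {poly rat} \o polyC))).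
Qed.

Lemma qvar_neq0 : qvar != 0.
Proof. by rewrite tofrac_eq0 polyX_eq0. Qed.

Lemma poly_at_qinv_neq0 p : p != 0 -> poly_at_qinv p != 0.
Proof.
move=> p0; set m := (size p).-1.
have sp : size p = m.+1 by rewrite prednK // size_poly_gt0.
have : tofrac (\poly_(i < m.+1) p`_(m - i)) != 0 :> Qq.
  rewrite tofrac_eq0; apply/eqP => /(congr1 (fun r : {poly rat} => r`_0)).
  rewrite coef_poly subn0 coef0 => /eqP.
  by rewrite -lead_coefE lead_coef_eq0 (negPf p0).
apply: contra_neq => pq0; rewrite -[RHS](mulr0 (qvar ^+ m)) -[in RHS]pq0.
rewrite /poly_at_qinv horner_poly sp poly_def rmorph_sum /= mulr_sumr.
rewrite (reindex_inj rev_ord_inj) /=; apply: eq_bigr => i _.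
have leim : (i <= m)%N by rewrite -ltnS.
rewrite subSS subKn // -mul_polyC tofracM tofracXn mulrCA; congr (_ * _).
by rewrite exprVn -exprB ?unitfE ?qvar_neq0.
Qed.

Lemma at_qinv_div p1 p2 : p2 != 0 ->
  at_qinv (tofrac p1 / tofrac p2) = poly_at_qinv p1 / poly_at_qinv p2.
Proof.
move=> p20; rewrite /at_qinv; set r := tofrac p1 / tofrac p2.
have d0 := denom_ratioP (repr r).
have rE : r = tofrac \n_(repr r) / tofrac \d_(repr r).
  by apply: (canRL (mulfK _)); rewrite ?tofrac_eq0 ?frac_repr.
apply/eqP; rewrite eqr_div ?poly_at_qinv_neq0 // -!poly_at_qinvM.
apply/eqP; congr poly_at_qinv; apply/eqP; rewrite -tofrac_eq !tofracM.
by rewrite -eqr_div ?tofrac_eq0 // -rE.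
Qed.

(* Main.v *)
(* Write D = x d/dx. The recursions compare two expressions for the coefficients
   of D f / f. For f = prod (1 + g_n x^n) the coefficient of x^n is
   sum_(d | n) (-1)^(d-1) (n/d) g_(n/d)^d. For f = exp_q it is (1-q)^(n-1)/[n],
   because exp_q(qx) = (1 - (1-q)x) exp_q(x). Since Exp_q = exp_(1/q), replacing
   q by 1/q gives the recursion for E_n. When n is odd, all n/d are odd and
   (1-q)^(n-1) = (q-1)^(n-1), so e_n = E_n by induction. Finally
   q -> 1/q is a field morphism, so by uniqueness of power products it maps e_n
   to E_n. *)

Require Import Defs.
From HB Require Import structures.
From mathcomp Require Import all_boot all_order all_algebra.
From mathcomp Require Import ring.
Import GRing.Theory.
Local Open Scope ring_scope.

(** * Logarithmic derivative of a power product *)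

Section LogDerivative.

Variables (F : fieldType) (g : nat -> F).

(* x d/dx log(1 + g_i x^i), with its series cut off after [M] terms *)
Definition factor_log_deriv (M i : nat) : {poly F} :=
  \sum_(1 <= d < M.+1) ((-1) ^+ d.-1 * (i%:R * g i ^+ d)) *: 'X^(i * d).

(** An alternating geometric sum: consecutive terms cancel, leaving [x] times the derivative of the
    factor and the first term past the cut-off. *)
Lemma mul_factor_log_deriv M i :
  (1 + g i *: 'X^i) * factor_log_deriv M i =
  (i%:R * g i) *: 'X^i
  - ((-1) ^+ M * (i%:R * g i ^+ M.+1)) *: 'X^(i * M.+1).
Proof.
elim: M => [|M IHM].
  by rewrite /factor_log_deriv big_geq // mulr0 muln1 expr1 expr0 mul1r subrr.
rewrite /factor_log_deriv big_nat_recr //= mulrDr IHM.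
rewrite -!mul_polyC !polyCM !rmorphXn /= rmorphN1 !mulnS !exprD !exprS.
ring.
Qed.

(** Leibniz rule, one factor at a time. The factor of index [i] adds an error divisible by
    [x^(i(M+1))], hence by [x^(M+1)] since [i >= 1]. *)
Lemma partial_product_log_deriv M N :
  'X^(M.+1) %| 'X * (partial_product g N)^`()
             - partial_product g N * \sum_(1 <= i < N.+1) factor_log_deriv M i.
Proof.
elim: N => [|N IHN].
  by rewrite /partial_product !big_geq // derivC !mulr0 subrr dvdp0.
rewrite big_nat_recr //=.
have -> : partial_product g N.+1 =
    partial_product g N * (1 + g N.+1 *: 'X^(N.+1)).
  by rewrite /partial_product big_nat_recr.
have XD : 'X * (1 + g N.+1 *: 'X^(N.+1))^`() =
    (N.+1%:R * g N.+1) *: 'X^(N.+1) :> {poly F}.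
  rewrite derivD derivC add0r derivZ derivXn -scalerAr mulrnAr -exprS.
  by rewrite -scaler_nat scalerA mulrC.
pose R := ((-1) ^+ M * (N.+1%:R * g N.+1 ^+ M.+1)) *: 'X^(N.+1 * M.+1).
have XDE : 'X * (1 + g N.+1 *: 'X^(N.+1))^`() =
    (1 + g N.+1 *: 'X^(N.+1)) * factor_log_deriv M N.+1 + R.
  by rewrite XD mul_factor_log_deriv subrK.
rewrite derivM mulrDr mulrA [X in _ + X - _]mulrCA XDE.
set P := partial_product g N in IHN *; set S := \sum_(_ <= i < _) _ in IHN *.
set L := factor_log_deriv _ _; set a := 1 + _ in XDE *; rewrite -/a.
have -> : 'X * P^`() * a + P * (a * L + R) - P * a * (S + L) =
    ('X * P^`() - P * S) * a + P * R by ring.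
apply: dvdp_add; first exact: dvdp_mulr.
rewrite /R -mul_polyC; do 2!apply: dvdp_mull.
by rewrite dvdp_exp2l // mulSn leq_addr.
Qed.

Definition log_deriv_coef (n : nat) : F :=
  \sum_(d <- divisors n) (-1) ^+ d.-1 * ((n %/ d)%:R * g (n %/ d)%N ^+ d).

Lemma coef_factor_log_deriv M m : (0 < m <= M)%N ->
  (\sum_(1 <= i < M.+1) factor_log_deriv M i)`_m = log_deriv_coef m.
Proof.
case/andP=> m_gt0 lemM; rewrite coef_sum.
under eq_bigr do rewrite coef_sum.
rewrite exchange_big_nat /=.
pose c d i : F := (-1) ^+ d.-1 * (i%:R * g i ^+ d).
(* For fixed [d], only the factor with [i * d = m] reaches degree [m]. *)
transitivity (\sum_(1 <= d < M.+1 | (d %| m)%N) c d (m %/ d)%N); last first.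
  rewrite -big_filter; apply: perm_big; apply: uniq_perm.
  - by rewrite filter_uniq ?iota_uniq.
  - exact: divisors_uniq.
  move=> d; rewrite mem_filter mem_index_iota -dvdn_divisors //.
  case dvd_dm: (d %| m)%N => //=.
  by rewrite (dvdn_gt0 m_gt0 dvd_dm) ltnS (leq_trans (dvdn_leq m_gt0 dvd_dm)).
rewrite [RHS]big_mkcond /=; apply: eq_big_nat => d /andP[d_gt0 _].
under eq_bigr do rewrite coefZ coefXn.
have [dvd_dm|ndvd_dm] := ifPn.
  rewrite (bigD1_seq (m %/ d)%N) ?iota_uniq //=; last first.
    rewrite mem_index_iota divn_gt0 // dvdn_leq //= ltnS.
    exact: leq_trans (leq_div _ _) lemM.
  rewrite divnK // eqxx mulr1 big1 ?addr0 // => i /negPf nei.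
  case: eqP => [mE|_]; last by rewrite mulr0.
  by rewrite mE mulnK // eqxx in nei.
apply: big1 => i _; case: eqP => [mE|_]; last by rewrite mulr0.
by rewrite mE dvdn_mull in ndvd_dm.
Qed.

(** Coefficient of [x^n] in [x f' = f * (x f' / f)]. Cutting both the product and the logarithmic
    series at [n] is enough, the error being divisible by [x^(n+1)]. *)
Lemma power_product_log_deriv (f : fps F) n : power_product f g ->
  n%:R * f n = \sum_(i < n) f i * log_deriv_coef (n - i).
Proof.
move=> /power_productP fg; have := partial_product_log_deriv n n.
case/dvdpP=> r /(congr1 (fun p : {poly F} => p`_n)) /eqP.
rewrite coefMXn ltnSn coefB subr_eq0 coefXM coefM => /eqP.
set S := \sum_(_ <= i < _) _ => PS.
(* The constant term vanishes, so the convolution stops at [i < n]. *)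
have S0 : S`_0 = 0.
  rewrite coef_sum big_nat big1 // => i /andP[i_gt0 _].
  rewrite coef_sum big_nat big1 // => d /andP[d_gt0 _].
  by rewrite coefZ coefXn eq_sym muln_eq0 !eqn0Ngt i_gt0 d_gt0 mulr0.
have -> : n%:R * f n = \sum_(i < n.+1) (partial_product g n)`_i * S`_(n - i).
  rewrite -PS coef_deriv; case: (n) fg => [|m] fg; first by rewrite mul0r.
  by rewrite /= fg // mulr_natl.
rewrite big_ord_recr /= subnn S0 mulr0 addr0; apply: eq_bigr => i _.
rewrite fg 1?ltnW // coef_factor_log_deriv //.
by rewrite subn_gt0 ltn_ord leq_subr.
Qed.

End LogDerivative.

(** The system is triangular with unit diagonal: the term [i = 0] is [s n], and the others involve
    only smaller indices. *)
Lemma log_deriv_unique {F : fieldType} (f : fps F) (s t : nat -> F) :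
  f 0%N = 1 ->
  (forall n, \sum_(i < n) f i * s (n - i)%N = \sum_(i < n) f i * t (n - i)%N) ->
  forall n, (0 < n)%N -> s n = t n.
Proof.
move=> f0 st; elim/ltn_ind=> -[//|n] IHn _.
have := st n.+1; rewrite !big_ord_recl /= f0 !mul1r subn0.
under eq_bigr => i _.
  rewrite IHn ?subn_gt0 ?ltn_subrL //; last by rewrite /bump /= add1n ltnS.
  over.
exact: addIr.
Qed.

(** * Arithmetic of q-integers *)

Lemma qintS {F : fieldType} (q : F) n : qint q n.+1 = qint q n + q ^+ n.
Proof. exact: big_ord_recr. Qed.

Lemma qintD {F : fieldType} (q : F) m n :
  qint q (m + n) = qint q m + q ^+ m * qint q n.
Proof.
elim: n => [|n IHn]; first by rewrite addn0 [qint q 0]big_ord0 mulr0 addr0.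
by rewrite addnS !qintS IHn mulrDr exprD addrA.
Qed.

Lemma qint_geom {F : fieldType} (q : F) n : (1 - q) * qint q n = 1 - q ^+ n.
Proof.
elim: n => [|n IHn]; first by rewrite [qint q 0]big_ord0 mulr0 subrr.
by rewrite qintS mulrDr IHn exprS; ring.
Qed.

Lemma qfactS {F : fieldType} (q : F) n : qfact q n.+1 = qfact q n * qint q n.+1.
Proof. by rewrite /qfact big_nat_recr. Qed.

Lemma qint_inv {F : fieldType} (q : F) n : q != 0 ->
  qint q^-1 n.+1 = qint q n.+1 / q ^+ n.
Proof.
move=> q0; elim: n => [|n IHn].
  by rewrite expr0 divr1 /qint !big_ord1.
have qSS : qint q n.+2 = 1 + q * qint q n.+1.
  by rewrite -[n.+2]add1n qintD expr1 [qint q 1]big_ord1.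
rewrite qintS IHn qSS exprVn exprS; field.
by rewrite expf_neq0.
Qed.

(** * Reciprocal and logarithmic derivative of the q-exponentials *)

Section QExp.
Variables (F : fieldType) (q : F).
Hypothesis qint_neq0 : forall n, qint q n.+1 != 0.

Lemma qfact_neq0 n : qfact q n != 0.
Proof.
elim: n => [|n IHn]; first by rewrite /qfact big_geq ?oner_neq0.
by rewrite qfactS mulf_neq0.
Qed.

Lemma qexpS n : qint q n.+1 * qexp q n.+1 = qexp q n.
Proof. by rewrite /qexp qfactS invfM mulrCA mulfV ?mulr1. Qed.

Lemma qExpS n : qint q n.+1 * qExp q n.+1 = q ^+ n * qExp q n.
Proof.
rewrite /qExp qfactS invfM binS bin1 exprD.
have := qint_neq0 n; have := qfact_neq0 n; move=> a b; field.
by rewrite a b.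
Qed.

Lemma negx_qexpS n :
  qint q n.+1 * fps_negx (qexp q) n.+1 = - fps_negx (qexp q) n.
Proof. by rewrite /fps_negx mulrCA qexpS exprS !mulN1r mulNr. Qed.

Lemma qExp_reciprocal : fps_reciprocal (qExp q) (fps_negx (qexp q)).
Proof.
case=> [|n]; first by rewrite /fps_mul big_ord1 /qExp /fps_negx /qexp
  /qfact big_geq // !expr0 invr1 !mulr1.
apply: (mulfI (qint_neq0 n)); rewrite mulr0 /fps_mul mulr_sumr.
(* Split [[n+1] = [i] + q^i [n+1-i]]. Since [[0] = 0], each half loses an end term; after a shift of
   index the halves are opposite. *)
rewrite (eq_bigr (fun i : 'I_n.+2 =>
  (qint q i * qExp q i) * fps_negx (qexp q) (n.+1 - i)%N +
  q ^+ i * qExp q i * (qint q (n.+1 - i) * fps_negx (qexp q) (n.+1 - i)%N))).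
  rewrite big_split /= big_ord_recl [X in _ + X]big_ord_recr /= subnn.
  rewrite [qint q 0]big_ord0 !mul0r mulr0 add0r addr0 -big_split /=.
  apply: big1 => i _; rewrite qExpS subSS subSn -1?ltnS //.
  by rewrite negx_qexpS mulrN addrN.
move=> i _; have lei : (i <= n.+1)%N by rewrite -ltnS.
by rewrite -{1}(subnKC lei) qintD; ring.
Qed.

(* The coefficient of x^(n+1) in x exp_q'(x) / exp_q(x) *)
Definition qlog_deriv (n : nat) : F := (1 - q) ^+ n / qint q n.+1.

(** Induction on [n] after multiplying by [[n+1]], which turns the left side into [(n+1)] times the
    previous coefficient. *)
Lemma qexp_log_deriv n :
  n%:R * qexp q n = \sum_(i < n) qexp q i * qlog_deriv (n - i).-1.
Proof.
elim: n => [|n IHn]; first by rewrite big_ord0 mul0r.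
apply: (mulfI (qint_neq0 n)); rewrite mulrCA qexpS mulr_sumr.
have leqi (i : 'I_n.+1) : (i <= n)%N by rewrite -ltnS.
(* [n+1] = [n+1-i] + q^(n+1-i) [i] *)
rewrite (eq_bigr (fun i : 'I_n.+1 =>
  qexp q i * (1 - q) ^+ (n - i) +
  (qint q i * qexp q i) * (q ^+ (n - i).+1 * qlog_deriv (n - i)))).
  (* The term [i = n] of the first half supplies the extra [qexp q n]; the term [i = 0] of the
     second half vanishes. *)
  rewrite big_split /= big_ord_recr [X in _ + X]big_ord_recl /= subnn expr0.
  rewrite [qint q 0]big_ord0 !mul0r add0r mulr1 addrAC -big_split /=.
  rewrite -natr1 mulrDl IHn mul1r; congr (_ + _).
  apply: eq_bigr => i _; rewrite qexpS -mulrDr; congr (_ * _).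
  have := ltn_ord i; rewrite -subn_gt0 /bump /= add1n subnS.
  case: (n - i)%N => //= m _; rewrite /qlog_deriv exprS.
  (* This gives [(1-q)^(m+1) + q^(m+1) L = L] for [L = (1-q)^m / [m+1]], matching the induction
     hypothesis term by term. *)
  have qX : q ^+ m.+1 = 1 - (1 - q) * qint q m.+1 by rewrite qint_geom subKr.
  rewrite qX; field; exact: qint_neq0.
move=> i _; rewrite (subSn (leqi i)) /= -{1}(subnK (leqi i)) -addSn qintD.
rewrite /qlog_deriv; field.
exact: qint_neq0.
Qed.
End QExp.

(** * Recursions for the factors *)

Section PowerProductQExp.
Variables (F : fieldType) (q : F) (g : nat -> F).
Hypothesis natr_neq0 : forall n, n.+1%:R != 0 :> F.
Hypothesis qint_neq0 : forall n, qint q n.+1 != 0.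
Hypothesis qexp_g : power_product (qexp q) g.

Lemma qexp_factor_rec n : (0 < n)%N ->
  g n = \sum_(d <- divisors n | (1 < d)%N)
          (-1) ^+ d * (g (n %/ d)%N ^+ d / d%:R)
        + (1 - q) ^+ (n - 1) / (n%:R * qint q n).
Proof.
move=> n_gt0.
have q0 : qexp q 0 = 1 by rewrite /qexp /qfact big_geq ?invr1.
have n0 : n%:R != 0 :> F by case: (n) n_gt0.
have gL : log_deriv_coef F g n = qlog_deriv F q n.-1.
  apply: (log_deriv_unique (qexp q) _ (fun m => qlog_deriv F q m.-1)) => // m.
  by rewrite -power_product_log_deriv // qexp_log_deriv.
have -> : (1 - q) ^+ (n - 1) / (n%:R * qint q n) = log_deriv_coef F g n / n%:R.
  by rewrite gL /qlog_deriv prednK // subn1 invfM mulrCA mulrC.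
(* The divisor [d = 1] contributes [n g_n], which is solved for after division by [n]; in the other
   terms [(n/d)/n] becomes [1/d]. *)
rewrite /log_deriv_coef (bigD1_seq 1%N) ?divisors_uniq //=; last first.
  by rewrite -dvdn_divisors.
rewrite expr0 mul1r divn1 expr1 mulrDl mulrAC mulfV // mul1r.
rewrite [X in _ = _ + (_ + X)]mulr_suml.
rewrite [X in _ = _ + (_ + X)](_ : _ = - \sum_(d <- divisors n | (1 < d)%N)
          (-1) ^+ d * (g (n %/ d)%N ^+ d / d%:R)); first by rewrite addrC subrK.
rewrite -sumrN big_seq_cond [RHS]big_seq_cond; apply: eq_big => [d|d].
  rewrite -dvdn_divisors //; case: (boolP (d %| n)%N) => //= /(dvdn_gt0 n_gt0).
  by case: d => [|[]].
rewrite -dvdn_divisors // => /andP[dvd_dn _].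
have d_gt0 := dvdn_gt0 n_gt0 dvd_dn.
have d0 : d%:R != 0 :> F by case: (d) d_gt0.
have nd0 : (n %/ d)%:R != 0 :> F.
  have : (0 < n %/ d)%N by rewrite divn_gt0 // dvdn_leq.
  by case: (n %/ d)%N.
rewrite -[in X in _ / X](divnK dvd_dn) natrM.
have -> : (-1) ^+ d = - (-1) ^+ d.-1 :> F.
  by rewrite -[in LHS](prednK d_gt0) exprS mulN1r.
by field; rewrite d0 nd0.
Qed.
End PowerProductQExp.

Lemma qfact_inv {F : fieldType} (q : F) n : q != 0 ->
  qfact q^-1 n = qfact q n / q ^+ 'C(n, 2).
Proof.
move=> q0; elim: n => [|n IHn]; first by rewrite /qfact !big_geq // divr1.
rewrite !qfactS IHn qint_inv // binS bin1 exprD.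
by field; rewrite !expf_neq0.
Qed.

Lemma qExpE {F : fieldType} (q : F) : q != 0 -> qExp q =1 qexp q^-1.
Proof. by move=> q0 n; rewrite /qexp qfact_inv // invfM invrK mulrC. Qed.

Lemma eq_power_product {F : fieldType} (f1 f2 : fps F) g :
  f1 =1 f2 -> power_product f1 g -> power_product f2 g.
Proof. by move=> f12 f1g k; rewrite -f12. Qed.

Section PowerProductQExpPair.
Variables (F : fieldType) (q : F) (e E : nat -> F).
Hypothesis natr_neq0 : forall n, n.+1%:R != 0 :> F.
Hypothesis q_neq0 : q != 0.
Hypothesis qint_neq0 : forall n, qint q n.+1 != 0.
Hypothesis qexp_e : power_product (qexp q) e.
Hypothesis qExp_E : power_product (qExp q) E.

(** The recursion for [exp_q] taken at [1/q]: both [(1-1/q)^(n-1)] and [[n]] at [1/q] carry a factor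
    [q^-(n-1)], which cancels. *)
Lemma qExp_factor_rec n : (0 < n)%N ->
  E n = \sum_(d <- divisors n | (1 < d)%N)
          (-1) ^+ d * (E (n %/ d)%N ^+ d / d%:R)
        + (q - 1) ^+ (n - 1) / (n%:R * qint q n).
Proof.
case: n => // n _.
have qintV_neq0 m : qint q^-1 m.+1 != 0.
  by rewrite qint_inv // mulf_neq0 // invr_eq0 expf_neq0.
have qexp_E := eq_power_product _ _ _ (qExpE q q_neq0) qExp_E.
rewrite [LHS](qexp_factor_rec _ _ _ natr_neq0 qintV_neq0 qexp_E) //.
congr (_ + _); rewrite qint_inv // subn1 /=.
have -> : 1 - q^-1 = (q - 1) / q by rewrite mulrBl mul1r mulfV.
rewrite exprMn exprVn.
move: n.+1%:R (natr_neq0 n) (qint q n.+1) (qint_neq0 n) => a a0 b b0; field.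
by rewrite a0 b0 expf_neq0.
Qed.

Lemma qexp_qExp_factor_odd n : odd n -> e n = E n.
Proof.
elim/ltn_ind: n => n IHn odd_n; have n_gt0 := odd_gt0 odd_n.
rewrite (qexp_factor_rec _ _ _ natr_neq0 qint_neq0 qexp_e) //.
rewrite qExp_factor_rec //; congr (_ + _ / _).
  rewrite big_seq_cond [RHS]big_seq_cond; apply: eq_bigr => d /andP[dn d_gt1].
  rewrite -dvdn_divisors // in dn; rewrite IHn ?ltn_Pdiv //.
  by move: odd_n; rewrite -{1}(divnK dn) oddM => /andP[].
by rewrite -opprB exprNn -signr_odd oddB // odd_n expr0 mul1r.
Qed.
End PowerProductQExpPair.

(** * The substitution of [1/q] for [q] as a field morphism *)

Section RMorphism.
Variables (F K : fieldType) (phi : {rmorphism F -> K}).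

Lemma rmorph_power_product (f : fps F) g :
  power_product f g -> power_product (phi \o f) (phi \o g).
Proof.
move=> fg k; have [N0 fN0] := fg k; exists N0 => N /fN0 /= <-.
suff -> : partial_product (phi \o g) N = map_poly phi (partial_product g N).
  by rewrite coef_map.
rewrite /partial_product rmorph_prod; apply: eq_bigr => i _.
rewrite rmorphD rmorph1 /= -!mul_polyC rmorphM /=.
by rewrite map_polyC map_polyXn.
Qed.

Lemma rmorph_qexp q : phi \o qexp q =1 qexp (phi q).
Proof.
move=> n; rewrite /= /qexp fmorphV /qfact rmorph_prod.
congr (_^-1); apply: eq_bigr => i _.
by rewrite /qint rmorph_sum; apply: eq_bigr => j _; rewrite rmorphXn.
Qed.
End RMorphism.

Lemma poly_at_qinv_is_zmod_morphism : zmod_morphism poly_at_qinv.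
Proof.
move=> p1 p2; rewrite /poly_at_qinv -hornerN -hornerD; congr (_.[_]).
exact: (rmorphB (map_poly (@FracField.tofrac {poly rat} \o polyC))).
Qed.

Lemma poly_at_qinvC c : poly_at_qinv c%:P = tofrac c%:P.
Proof.
rewrite /poly_at_qinv.
rewrite [map_poly _ _](map_polyC (@FracField.tofrac {poly rat} \o polyC)).
by rewrite hornerC.
Qed.

Lemma poly_at_qinvX : poly_at_qinv 'X = qvar^-1.
Proof.
rewrite /poly_at_qinv.
rewrite [map_poly _ _](map_polyX (@FracField.tofrac {poly rat} \o polyC)).
by rewrite hornerX.
Qed.

Lemma at_qinv_tofrac p : at_qinv (tofrac p) = poly_at_qinv p.
Proof.
rewrite -[tofrac p]divr1 -tofrac1 at_qinv_div ?oner_neq0 //.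
by rewrite -polyC1 poly_at_qinvC polyC1 tofrac1 divr1.
Qed.

(** Puts elements in the form required by [at_qinv_div], so that the morphism laws can be checked
    without tracking the chosen representatives. *)
Lemma fracP (r : Qq) : exists p1 p2, p2 != 0 /\ r = tofrac p1 / tofrac p2.
Proof.
exists \n_(repr r), \d_(repr r); split; first exact: denom_ratioP.
by apply: (canRL (mulfK _)); rewrite ?tofrac_eq0 ?denom_ratioP ?frac_repr.
Qed.

Lemma at_qinv_is_zmod_morphism : zmod_morphism at_qinv.
Proof.
move=> r s; have [p1 [p2 [p20 ->]]] := fracP r.
have [s1 [s2 [s20 ->]]] := fracP s.
rewrite -mulNr -tofracN addf_div ?tofrac_eq0 // -!tofracM -tofracD.
rewrite !at_qinv_div ?mulf_neq0 // mulNr poly_at_qinv_is_zmod_morphism.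
by rewrite !poly_at_qinvM -[in RHS]mulNr addf_div ?poly_at_qinv_neq0 // mulNr.
Qed.

Lemma at_qinv_is_monoid_morphism : monoid_morphism at_qinv.
Proof.
split; first by rewrite -tofrac1 at_qinv_tofrac -polyC1 poly_at_qinvC.
move=> r s; have [p1 [p2 [p20 ->]]] := fracP r.
have [s1 [s2 [s20 ->]]] := fracP s.
rewrite mulf_div -!tofracM !at_qinv_div ?mulf_neq0 // !poly_at_qinvM.
by rewrite mulf_div.
Qed.

HB.instance Definition _ :=
  GRing.isZmodMorphism.Build Qq Qq at_qinv at_qinv_is_zmod_morphism.
HB.instance Definition _ :=
  GRing.isMonoidMorphism.Build Qq Qq at_qinv at_qinv_is_monoid_morphism.

Lemma at_qinv_qvar : at_qinv qvar = qvar^-1.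
Proof. by rewrite at_qinv_tofrac poly_at_qinvX. Qed.

Lemma Qq_natr_neq0 n : n.+1%:R != 0 :> Qq.
Proof.
rewrite -tofrac1 -tofracMn tofrac_eq0 -polyC_natr polyC_eq0.
by rewrite Num.Theory.pnatr_eq0.
Qed.

Lemma qint_qvar_neq0 n : qint qvar n.+1 != 0.
Proof.
have -> : qint qvar n.+1 = tofrac (\sum_(i < n.+1) 'X^i).
  by rewrite rmorph_sum; apply: eq_bigr => i _; rewrite rmorphXn.
(* As a polynomial in [q], [[n+1]] takes the value 1 at [q = 0]. *)
rewrite tofrac_eq0; apply/eqP => /(congr1 (fun p : {poly rat} => p.[0])).
rewrite horner_sum big_ord_recl /= expr0 hornerC horner0 big1 => [/eqP|i _].
  by rewrite addr0 oner_eq0.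
by rewrite hornerXn expr0n.
Qed.

Theorem theorem4p1 (e E : nat -> Qq)
    (he : power_product (qexp qvar) e) (hE : power_product (qExp qvar) E) :
  (forall n : nat, (1 <= n)%N ->
     e n = \sum_(d <- divisors n | (1 < d)%N)
             (-1) ^+ d * (e (n %/ d)%N ^+ d / d%:R)
           + (1 - qvar) ^+ (n - 1) / (n%:R * qint qvar n) /\
     E n = \sum_(d <- divisors n | (1 < d)%N)
             (-1) ^+ d * (E (n %/ d)%N ^+ d / d%:R)
           + (qvar - 1) ^+ (n - 1) / (n%:R * qint qvar n)) /\
  (qExp qvar =1 qexp qvar^-1 /\
   fps_reciprocal (qExp qvar) (fps_negx (qexp qvar))) /\
  (forall n : nat,
     e (2 * n + 1)%N = E (2 * n + 1)%N /\
     E (2 * n + 1)%N = at_qinv (e (2 * n + 1)%N)).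
Proof.
have eE := qexp_factor_rec _ _ _ Qq_natr_neq0 qint_qvar_neq0 he.
have EE := qExp_factor_rec _ _ _ Qq_natr_neq0 qvar_neq0 qint_qvar_neq0 hE.
split; first by move=> n n_gt0; split; [exact: eE | exact: EE].
split.
  split; first exact: qExpE qvar_neq0.
  exact: qExp_reciprocal qint_qvar_neq0.
move=> n; split.
  apply: (qexp_qExp_factor_odd _ _ _ _ Qq_natr_neq0 qvar_neq0 qint_qvar_neq0
            he hE).
  by rewrite mul2n addn1 /= odd_double.
(* The image of the expansion of [exp_q] expands [exp_(1/q) = Exp_q], so uniqueness applies; parity
   is used only for [e = E] above. *)
have atE : power_product (qExp qvar) (at_qinv \o e).
  have := rmorph_power_product _ _ at_qinv _ _ he.
  apply: eq_power_product => k.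
  by rewrite rmorph_qexp qExpE ?qvar_neq0 //= at_qinv_qvar.
by apply: (power_product_unique hE atE); rewrite addn1.
Qed.
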